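(* Let $\mathrm{pr}\colon\mathbb{R}^3\to\mathbb{R}^2$, $\mathrm{pr}(x,y,z)=(x,y)$, be the projection. The map $p\colon\mathrm{cw}(\mathbb{R}^3)\to\mathrm{cw}(\mathbb{R}^2)$, $p(A)=\mathrm{pr}(A)$, is not open.
   Context: $\mathrm{cc}(\mathbb{R}^n)$ denotes the set of all nonempty compact convex subsets of Euclidean space $\mathbb{R}^n$, with the topology generated by the Hausdorff metric; its subsets carry the subspace topology. For $K\in\mathrm{cc}(\mathbb{R}^n)$, the support function $h_K\colon S^{n-1}\to\mathbb{R}$ is $h_K(u)=\max\{\langle x,u\rangle\mid x\in K\}$, where $\langle\cdot,\cdot\rangle$ is the standard inner product and $S^{n-1}$ is the unit sphere, and the width function is $w_K(u)=h_K(u)+h_K(-u)$. $K$ is of constant width $d>0$ if $w_K$ is the constant function with value $d$. For $d>0$, $\mathrm{cw}_d(\mathbb{R}^n)\subset\mathrm{cc}(\mathbb{R}^n)$ is the set of compact convex bodies of constant width $d$, and $\mathrm{cw}(\mathbb{R}^n)=\bigcup_{d>0}\mathrm{cw}_d(\mathbb{R}^n)$. The image under $\mathrm{pr}$ of a body of constant width $d$ in $\mathbb{R}^3$ is a body of constant width $d$ in $\mathbb{R}^2$, so $p$ is well defined. A map is open if it sends open sets to open subsets of its codomain. *)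

(* Defs.v *)
From HB Require Import structures.
From mathcomp Require Import all_boot all_order all_algebra.
From mathcomp Require Import all_classical all_reals all_analysis.
From mathcomp Require Import ring lra.

Set Implicit Arguments.
Unset Strict Implicit.
Unset Printing Implicit Defensive.

Import Order.TTheory GRing.Theory Num.Def Num.Theory.
Import numFieldNormedType.Exports.

Local Open Scope classical_set_scope.
Local Open Scope ring_scope.

(* The norm provided by the library on ['rV[R]_n] is the sup norm, whence a
   separate Euclidean norm. Both induce the same topology, so [compact] below
   is the usual notion. *)
Section Euclidean.
Context {R : realType} {n : nat}.
Implicit Types x y : 'rV[R]_n.

Definition dotv x y : R := \sum_(i < n) x 0 i * y 0 i.

Definition enorm x : R := Num.sqrt (dotv x x).

Definition usphere : set 'rV[R]_n := [set u | enorm u = 1].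

Lemma dotvC x y : dotv x y = dotv y x.
Proof. by apply: eq_bigr => i _; rewrite mulrC. Qed.

Lemma dotvDl x y z : dotv (x + y) z = dotv x z + dotv y z.
Proof.
by rewrite -big_split/=; apply: eq_bigr => i _; rewrite mxE mulrDl.
Qed.

Lemma dotvZl a x y : dotv (a *: x) y = a * dotv x y.
Proof.
by rewrite /dotv mulr_sumr; apply: eq_bigr => i _; rewrite mxE mulrA.
Qed.

Lemma dotv_ge0 x : 0 <= dotv x x.
Proof. by apply: sumr_ge0 => i _; rewrite -expr2 sqr_ge0. Qed.

Lemma coord_sqr_le x i : x 0 i ^+ 2 <= dotv x x.
Proof.
rewrite /dotv (bigD1 i)//= expr2 lerDl.
by apply: sumr_ge0 => j _; rewrite -expr2 sqr_ge0.
Qed.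

Lemma dotv_eq0 x : dotv x x = 0 -> x = 0.
Proof.
move=> x0; apply/rowP => i; rewrite mxE; apply/eqP.
by rewrite -sqrf_eq0 eq_le sqr_ge0 andbT -x0 coord_sqr_le.
Qed.

Lemma enorm_ge0 x : 0 <= enorm x. Proof. exact: sqrtr_ge0. Qed.

Lemma enorm_sqr x : enorm x ^+ 2 = dotv x x.
Proof. by rewrite sqr_sqrtr ?dotv_ge0. Qed.

Lemma enorm0 : enorm 0 = 0.
Proof.
by rewrite /enorm /dotv big1 ?sqrtr0// => i _; rewrite mxE mul0r.
Qed.

Lemma enormN x : enorm (- x) = enorm x.
Proof.
by congr Num.sqrt; apply: eq_bigr => i _; rewrite !mxE mulrNN.
Qed.

Lemma enormB x y : enorm (x - y) = enorm (y - x).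
Proof. by rewrite -enormN opprB. Qed.

Lemma dotv_le_enorm x y : dotv x y <= enorm x * enorm y.
Proof.
have [y0|y0] := eqVneq (dotv y y) 0.
  have -> : dotv x y = 0.
    by rewrite (dotv_eq0 y0) /dotv big1// => i _; rewrite mxE mulr0.
  by rewrite mulr_ge0 ?enorm_ge0.
have yy : 0 < dotv y y by rewrite lt_neqAle eq_sym y0 dotv_ge0.
have : 0 <= dotv y y * (dotv x x * dotv y y - dotv x y ^+ 2).
  have := dotv_ge0 (dotv y y *: x + (- dotv x y) *: y).
  rewrite dotvDl !dotvZl !(dotvC _ (_ + _)) !dotvDl !dotvZl (dotvC y x).
  by congr (0 <= _); ring.
rewrite pmulr_rge0// subr_ge0 -!enorm_sqr -exprMn => h.
apply: le_trans (ler_norm _) _.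
by rewrite -(@ler_pXn2r _ 2)// ?nnegrE ?mulr_ge0 ?enorm_ge0// real_normK ?num_real.
Qed.

Lemma enormD x y : enorm (x + y) <= enorm x + enorm y.
Proof.
rewrite -(@ler_pXn2r _ 2)// ?nnegrE ?addr_ge0 ?enorm_ge0//.
rewrite sqrrD !enorm_sqr dotvDl !(dotvC _ (_ + _)) !dotvDl (dotvC y x).
by have := dotv_le_enorm x y; lra.
Qed.

Lemma mx_norm_le_enorm x : `|x| <= enorm x.
Proof.
rewrite [leLHS]/normr/= mx_normrE; apply/bigmax_leP; split=> /=.
  exact: enorm_ge0.
move=> [i j] _ /=; rewrite ord1 -(@ler_pXn2r _ 2)// ?nnegrE ?enorm_ge0//.
by rewrite real_normK ?num_real// enorm_sqr coord_sqr_le.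
Qed.

Lemma enorm_le_mx_norm x : enorm x <= n%:R * `|x| ^+ 2 + 1.
Proof.
suff : enorm x ^+ 2 <= n%:R * `|x| ^+ 2.
  by have := sqr_ge0 (enorm x - 1); have := enorm_ge0 x; nra.
rewrite enorm_sqr -[n in n%:R]card_ord mulr_natl -sumr_const.
apply: ler_sum => i _; rewrite -expr2 -[leLHS]real_normK ?num_real//.
rewrite ler_pXn2r// ?nnegrE//.
rewrite [leRHS]/normr/= mx_normrE; apply/bigmax_geP; right => /=.
by exists (0, i).
Qed.

Lemma continuous_dotvl u : continuous (fun x => dotv x u).
Proof.
rewrite /dotv; elim: (index_enum _) => [|i s IHs].
  rewrite (_ : (fun _ => _) = cst 0); first exact: cst_continuous.
  by apply/funext => y; rewrite big_nil.
rewrite (_ : (fun _ => _) =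
    (fun y : 'rV_n => y 0 i * u 0 i + \sum_(j <- s) y 0 j * u 0 j)); last first.
  by apply/funext => y; rewrite big_cons.
move=> x; apply: (@cvgD _ _ _ _ _ (fun y : 'rV_n => y 0 i * u 0 i) _ _ _ _ (IHs x)).
by apply: cvgMl; exact: coord_continuous.
Qed.

End Euclidean.

Arguments usphere {R n}.

Record cc (R : realType) (n : nat) := CC {
  cc_set :> set 'rV[R]_n ;
  cc_nonempty : cc_set !=set0 ;
  cc_compact : compact cc_set ;
  cc_convex : convex_set cc_set }.

HB.instance Definition _ (R : realType) (n : nat) := gen_eqMixin (cc R n).
HB.instance Definition _ (R : realType) (n : nat) := gen_choiceMixin (cc R n).

Section Hausdorff.
Context {R : realType} {n : nat}.
Implicit Types A B C : cc R n.

Lemma cc_inj A B : cc_set A = cc_set B -> A = B.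
Proof.
case: A B => [A A1 A2 A3] [B B1 B2 B3] /= E; subst B.
by congr CC; exact: Prop_irrelevance.
Qed.

Definition eneighborhood (A : set 'rV[R]_n) (e : R) : set 'rV[R]_n :=
  [set x | exists2 a, A a & enorm (x - a) < e].

Definition hradii (A B : set 'rV[R]_n) : set R :=
  [set e | [/\ 0 < e, A `<=` eneighborhood B e & B `<=` eneighborhood A e]].

Definition hdist A B : R := inf (hradii A B).

Lemma hradii_sym (A B : set 'rV[R]_n) : hradii A B = hradii B A.
Proof. by apply/seteqP; split=> e []. Qed.

Lemma cc_ebounded A : exists M, forall a, cc_set A a -> enorm a <= M.
Proof.
have [M [_ hM]] := compact_bounded (@cc_compact _ _ A).
exists (n%:R * (`|M| + 1) ^+ 2 + 1) => a Aa.
apply: le_trans (enorm_le_mx_norm a) _; rewrite lerD2r ler_wpM2l//.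
rewrite ler_pXn2r// ?nnegrE ?addr_ge0//.
by apply: hM Aa; rewrite (le_lt_trans (ler_norm _))// ltrDl.
Qed.

Lemma hradii_has_inf A B : has_inf (hradii A B).
Proof.
split; last by exists 0 => e [/ltW].
have [M hM] := cc_ebounded A; have [N hN] := cc_ebounded B.
have [a Aa] := cc_nonempty A; have [b Bb] := cc_nonempty B.
have M0 : 0 <= M := le_trans (enorm_ge0 _) (hM _ Aa).
have N0 : 0 <= N := le_trans (enorm_ge0 _) (hN _ Bb).
have h x y : enorm x <= M -> enorm y <= N -> enorm (x - y) < M + N + 1.
  by move=> xM yN; have := enormD x (- y); rewrite enormN; lra.
exists (M + N + 1); split; first by lra.
- by move=> x Ax; exists b => //; exact: h (hM _ Ax) (hN _ Bb).
- by move=> y By; exists a => //; rewrite enormB; exact: h (hM _ Aa) (hN _ By).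
Qed.

Lemma hradii_gt A B e : hdist A B < e -> hradii A B e.
Proof.
move=> he; have e0 : 0 < e - hdist A B by rewrite subr_gt0.
have [d [d0 dA dB]] := inf_adherent e0 (hradii_has_inf A B).
rewrite -/(hdist A B) addrC subrK => de; split; first exact: lt_trans de.
- by move=> x /dA[b Bb xb]; exists b => //; exact: lt_trans de.
- by move=> x /dB[b Bb xb]; exists b => //; exact: lt_trans de.
Qed.

Lemma hdist_le A B e : hradii A B e -> hdist A B <= e.
Proof. by move=> he; apply: ge_inf => //; case: (hradii_has_inf A B). Qed.

Lemma hdist_ge0 A B : 0 <= hdist A B.
Proof.
by apply: lb_le_inf; [case: (hradii_has_inf A B)|move=> e [/ltW]].
Qed.

Lemma hdistxx A : hdist A A = 0.
Proof.
apply/eqP; rewrite eq_le hdist_ge0 andbT; apply/ler_addgt0Pl => e e0.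
by rewrite addr0; apply: hdist_le; split=> // a Aa; exists a;
  rewrite ?subrr ?enorm0.
Qed.

Lemma hdist_sym A B : hdist A B = hdist B A.
Proof. by rewrite /hdist hradii_sym. Qed.

Lemma hdist_triangle B A C : hdist A C <= hdist A B + hdist B C.
Proof.
apply/ler_addgt0Pl => e e0.
have /hradii_gt[d0 AB BA] : hdist A B < hdist A B + e / 2 by lra.
have /hradii_gt[d'0 BC CB] : hdist B C < hdist B C + e / 2 by lra.
have tri (x y z : 'rV[R]_n) : enorm (x - z) <= enorm (x - y) + enorm (y - z).
  by rewrite -(subrKA y x (- z)); exact: enormD.
apply: hdist_le; split; first by lra.
- move=> a /AB[b /BC[c Cc bc] ab]; exists c => //.
  by have := tri a b c; lra.
- move=> c /CB[b /BA[a Aa ba] cb]; exists a => //.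
  by have := tri c b a; lra.
Qed.

Lemma hdist_eq0_sub A B : hdist A B = 0 -> A `<=` B.
Proof.
move=> AB a Aa; have Bcl : closed B.
  by apply: compact_closed; [exact: norm_hausdorff|exact: cc_compact].
apply: Bcl => V /nbhs_ballP[e /= e0 eV].
have /hradii_gt[_ /(_ _ Aa)[b Bb ab] _] : hdist A B < e by rewrite AB.
exists b; split=> //; apply: eV; rewrite -ball_normE/=.
exact: le_lt_trans (mx_norm_le_enorm _) ab.
Qed.

Lemma hdist_positivity A B : hdist A B = 0 -> A = B.
Proof.
move=> AB; apply: cc_inj; apply/seteqP; split; apply: hdist_eq0_sub => //.
by rewrite hdist_sym.
Qed.

HB.instance Definition _ := isMetric.Build R (cc R n)
  hdistxx hdist_positivity hdist_sym hdist_triangle.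

End Hausdorff.

Section ConstantWidth.
Context {R : realType} {n : nat}.
Implicit Types (K : set 'rV[R]_n) (u : 'rV[R]_n).

(* For K in [cc R n] this supremum is a maximum, see [support_max]. *)
Definition support K u : R := sup [set dotv x u | x in K].

Definition width K u : R := support K u + support K (- u).

Lemma support_max (A : cc R n) u :
  exists2 x, cc_set A x & support A u = dotv x u /\
                   forall y, cc_set A y -> dotv y u <= dotv x u.
Proof.
have cdot : {within A, continuous (fun x => dotv x u)}.
  exact/continuous_subspaceT/continuous_dotvl.
have [x /set_mem Ax xmax] :=
  compact_EVT_max (cc_nonempty A) (@cc_compact _ _ A) cdot.
have {}xmax y : cc_set A y -> dotv y u <= dotv x u by move=> Ay; exact/xmax/mem_set.
exists x => //; split=> //; apply/eqP; rewrite eq_le; apply/andP; split.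
  by apply: ge_sup; [exists (dotv x u), x|move=> _ [y Ay <-]; exact: xmax].
apply: ub_le_sup; last by exists x.
by exists (dotv x u) => _ [y Ay <-]; exact: xmax.
Qed.

Definition cw_ (d : R) : set (cc R n) :=
  [set K | forall u, usphere u -> width K u = d].

Definition cw : set (cc R n) := \bigcup_(d in [set d : R | 0 < d]) cw_ d.

End ConstantWidth.

Arguments cw R n : clear implicits.

Section Projection.
Context {R : realType}.

Definition pr (x : 'rV[R]_3) : 'rV[R]_2 := @lsubmx R 1 2 1 x.

Lemma prE (x : 'rV[R]_3) (i : 'I_2) : pr x 0 i = x 0 (widen_ord (leqnSn 2) i).
Proof. by rewrite mxE; congr (x _ _); apply/val_inj. Qed.

Lemma pr_continuous : continuous pr.
Proof.
move=> x V /nbhs_ballP[e /= e0 eV]; apply/nbhs_ballP; exists e => //= y [_ xy].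
by apply: eV; split=> // i j; rewrite ord1 !prE; exact: xy.
Qed.

Lemma pr_nonempty (A : cc R 3) : (pr @` A) !=set0.
Proof. by have [x Ax] := cc_nonempty A; exists (pr x), x. Qed.

Lemma pr_compact (A : cc R 3) : compact (pr @` A).
Proof.
apply: continuous_compact; last exact: cc_compact.
exact/continuous_subspaceT/pr_continuous.
Qed.

Lemma pr_convex (A : cc R 3) : convex_set (pr @` A).
Proof.
move=> _ _ t /set_mem[x Ax <-] /set_mem[y Ay <-]; apply/mem_set.
have /set_mem Axy := cc_convex t (mem_set Ax) (mem_set Ay).
exists (conv t (x : convex_lmodType _) y) => //.
by apply/rowP => i; rewrite prE !mxE -!prE !mxE.
Qed.

Definition pr_cc (A : cc R 3) : cc R 2 :=
  CC (pr_nonempty A) (@pr_compact A) (@pr_convex A).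

Definition lift0 (u : 'rV[R]_2) : 'rV[R]_3 := @row_mx R 1 2 1 u 0.

Lemma dotv_pr (x : 'rV[R]_3) (u : 'rV[R]_2) : dotv (pr x) u = dotv x (lift0 u).
Proof.
rewrite /dotv [RHS](@big_split_ord _ _ _ 2 1)/= [X in _ = _ + X]big1 ?addr0;
  last first.
  by move=> i _; rewrite /lift0 (@row_mxEr R 1 2 1) mxE mulr0.
by apply: eq_bigr => i _; rewrite /lift0 (@row_mxEl R 1 2 1) mxE.
Qed.

Lemma pr_lift0 (u : 'rV[R]_2) : pr (lift0 u) = u.
Proof. exact: row_mxKl. Qed.

Lemma support_pr (A : set 'rV[R]_3) u : support (pr @` A) u = support A (lift0 u).
Proof.
congr sup; apply/seteqP; split=> [_ [_ [x Ax <-] <-]|_ [x Ax <-]].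
  by exists x => //; rewrite dotv_pr.
by exists (pr x); [exists x|rewrite dotv_pr].
Qed.

Lemma pr_cw_ d (A : cc R 3) : cw_ d A -> cw_ d (pr_cc A).
Proof.
move=> Ad u u1; rewrite -(Ad (lift0 u)); last first.
  by rewrite /usphere/= /enorm -dotv_pr pr_lift0.
rewrite /width !support_pr; congr (_ + support _ _).
by rewrite /lift0 (@opp_row_mx R 1 2 1) oppr0.
Qed.

Lemma pr_cw (A : cc R 3) : cw R 3 A -> cw R 2 (pr_cc A).
Proof. by move=> [d d0 Ad]; exists d => //; exact: pr_cw_. Qed.

(* A set coerces to the corresponding subtype, which carries the subspace
   topology. *)
Definition p (A : cw R 3) : cw R 2 :=
  exist _ (pr_cc (set_val A)) (mem_set (pr_cw (set_valP A))).

Lemma pE (A : cw R 3) : set_val (p A) = pr @` set_val A :> set 'rV[R]_2.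
Proof. by []. Qed.

End Projection.

Arguments p R : clear implicits.

Definition open_map (X Y : topologicalType) (f : X -> Y) : Prop :=
  forall U : set X, open U -> open (f @` U).

(* Main.v *)
Require Import Defs.
From mathcomp Require Import all_boot all_order all_algebra.
From mathcomp Require Import all_classical all_reals all_analysis.
From mathcomp Require Import ring lra.

Set Implicit Arguments.
Unset Strict Implicit.
Unset Printing Implicit Defensive.

Import Order.TTheory GRing.Theory Num.Def Num.Theory.
Import numFieldNormedType.Exports.

Local Open Scope classical_set_scope.
Local Open Scope ring_scope.

(** Bodies whose shadow is a Reuleaux polygon are rigid in a way in which bodies
with a round shadow are not.  A body [A] of constant width 2 has diameter
at most 2 ([cw_diam]).  Hence, if two points of its shadow are at distance
exactly 2, any points of [A] above them have the same height
([star_lift_height]).  In a Reuleaux polygon the vertices, taken in star order,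
are consecutively at distance 2; so if the shadow of [A] is a Reuleaux polygon,
all the vertices lift to a single height.

On the other hand there is a body [A0] of constant width 2 whose shadow is the
unit disc but whose horizontal rim is not flat: the body with support function
[1 + e * z * x ^ 2] on the unit sphere, for a small [e].  The perturbation is
odd, so the width is constant; it vanishes on the equator, so the shadow is the
disc; and the rim point above [(cos t, sin t)] has height [e * cos t ^ 2]
([bump_ex], [pr_bump], [bump_high], [bump_low]).

Regular Reuleaux polygons with many vertices converge to the disc
([star_radius_cvg], [hdist_disc_star]).  They have a vertex [(r, 0)] with
[r >= 1] and a vertex whose second coordinate is 1 or -1.  A body near [A0] has
different heights above these two vertices, so its shadow is not one of these
polygons ([far_from_bump]).  Thus the image of a small ball around [A0] omits
bodies arbitrarily close to the image of [A0], and is not open.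

That Reuleaux polygons have constant width is derived from a criterion on the
vertex set [S] alone ([ball_hull_cw]): the intersection of the balls of radius
2 centred in [S] has width 2 as soon as [S] has diameter at most 2 and every
direction, up to sign, lies in the cone spanned by the directions of two
diameters of [S] that lead to the same vertex [s]. *)

(** * Support functions and width *)

Section Euclidean.
Context {R : realType} {n : nat}.
Implicit Types (x y u v : 'rV[R]_n) (A : cc R n).

Lemma dotvDr x y u : dotv u (x + y) = dotv u x + dotv u y.
Proof. by rewrite dotvC dotvDl !(dotvC _ u). Qed.

Lemma dotvZr (a : R) x y : dotv x (a *: y) = a * dotv x y.
Proof. by rewrite dotvC dotvZl dotvC. Qed.

Lemma dotvNl x y : dotv (- x) y = - dotv x y.
Proof. by rewrite -scaleN1r dotvZl mulN1r. Qed.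

Lemma dotvNr x y : dotv x (- y) = - dotv x y.
Proof. by rewrite dotvC dotvNl dotvC. Qed.

Definition dotvE :=
  (@dotvDl R n, dotvDr, dotvNl, dotvNr, @dotvZl R n, dotvZr).

Lemma enormZ (a : R) x : enorm (a *: x) = `|a| * enorm x.
Proof. by rewrite /enorm dotvZl dotvZr mulrA -expr2 sqrtrM ?sqr_ge0// sqrtr_sqr. Qed.

Lemma enorm_le_dotv x (c : R) : 0 <= c -> (enorm x <= c) = (dotv x x <= c ^+ 2).
Proof.
by move=> c0; rewrite -enorm_sqr ler_pXn2r// nnegrE ?enorm_ge0.
Qed.

Lemma dotv_usphere u : usphere u -> dotv u u = 1.
Proof. by move=> u1; rewrite -enorm_sqr u1 expr1n. Qed.

Lemma usphereN u : usphere u -> usphere (- u).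
Proof. by rewrite /usphere/= enormN. Qed.

Lemma usphere_dotv u : dotv u u = 1 -> usphere u.
Proof. by move=> u1; rewrite /usphere/= /enorm u1 sqrtr1. Qed.

Lemma enormP x (c : R) : 0 <= c ->
  (forall u, usphere u -> dotv x u <= c) -> enorm x <= c.
Proof.
move=> c0 xc; have [x0|x0] := eqVneq (enorm x) 0; first by rewrite x0.
have {xc} := xc ((enorm x)^-1 *: x).
rewrite dotvZr -enorm_sqr expr2 mulrA mulVf// mul1r; apply.
by rewrite /usphere/= enormZ ger0_norm ?invr_ge0 ?enorm_ge0// mulVf.
Qed.

Lemma dotv_le x u (c : R) : usphere u -> enorm x <= c -> dotv x u <= c.
Proof. by move=> u1; apply: le_trans; rewrite (le_trans (dotv_le_enorm x u)) ?u1 ?mulr1. Qed.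

Definition halfspaces (H : 'rV[R]_n -> R -> Prop) : set 'rV[R]_n :=
  [set x | forall v c, H v c -> dotv x v <= c].

(** Both bodies of the proof are described by linear inequalities; closedness and
convexity then come for free, and one bounded inequality in each direction gives
compactness. *)
Lemma halfspaces_cc (H : 'rV[R]_n -> R -> Prop) (M : R) :
    halfspaces H !=set0 ->
    (forall v, usphere v -> exists2 c, H v c & c <= M) ->
  exists A : cc R n, cc_set A = halfspaces H.
Proof.
move=> H0 HM.
have Hclosed : closed (halfspaces H).
  have -> : halfspaces H =
      \bigcap_(vc in [set vc : _ * _ | H vc.1 vc.2]) [set x | dotv x vc.1 <= vc.2].
    apply/seteqP; split=> [x Hx [v c]/= Hvc|x Hx v c Hvc]; first exact: Hx.
    exact: (Hx (v, c)).
  apply: closed_bigI => -[v c] _ /=.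
  by apply: (closed_comp (f := fun x => dotv x v)) (@closed_le R c) => x _; exact: continuous_dotvl.
have Hcompact : compact (halfspaces H).
  apply: bounded_closed_compact => //; exists `|M|; split; first exact: num_real.
  move=> N MN x Hx; apply: (le_trans (mx_norm_le_enorm x)).
  apply: le_trans (ltW MN); apply: enormP => // v /HM[c Hvc cM].
  exact: le_trans (Hx _ _ Hvc) (le_trans cM (ler_norm M)).
have Hconvex : convex_set (halfspaces H).
  move=> x y t /set_mem Hx /set_mem Hy; apply/mem_set => v c Hvc.
  rewrite /conv/= dotvDl !dotvZl/= /unstable.onem.
  have := Hx _ _ Hvc; have := Hy _ _ Hvc.
  have t0 : 0 <= t%:num :> R by [].
  have t1 : t%:num <= 1 :> R by [].
  by nra.
by exists (CC H0 Hcompact Hconvex).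
Qed.

Lemma support_eq (K : set 'rV[R]_n) x u : K x ->
  (forall y, K y -> dotv y u <= dotv x u) -> Defs.support K u = dotv x u.
Proof.
move=> Kx xmax; apply/eqP; rewrite eq_le; apply/andP; split.
  by apply: ge_sup; [exists (dotv x u), x|move=> _ [y Ky <-]; exact: xmax].
apply: ub_le_sup; last by exists x.
by exists (dotv x u) => _ [y Ky <-]; exact: xmax.
Qed.

Lemma support_ge A x u : cc_set A x -> dotv x u <= Defs.support A u.
Proof. by move=> Ax; have [z _ [-> zmax]] := support_max A u; exact: zmax. Qed.

Lemma cw_diam A (d : R) x y : 0 <= d -> cw_ d A -> cc_set A x -> cc_set A y -> enorm (x - y) <= d.
Proof.
move=> d0 Ad Ax Ay; apply: enormP => // u u1.
rewrite -(Ad u u1) /width dotvDl dotvNl -dotvNr.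
by rewrite lerD// support_ge.
Qed.

(** The support function is at least [2 - r] in every direction, and opposite
values add up to 2, so it is at most [r]. *)
Lemma cw_sub_ball A (r : R) : 0 <= r -> cw_ 2 A ->
    (forall x, enorm x <= 1 -> cc_set A ((2 - r) *: x)) ->
  forall x, cc_set A x -> enorm x <= r.
Proof.
move=> r0 A2 Ar x Ax; apply: enormP => // u u1.
have := A2 u u1; rewrite /width; have := support_ge u Ax.
have /(support_ge (- u)) : cc_set A ((2 - r) *: (- u)) by apply: Ar; rewrite enormN u1.
by rewrite dotvZl dotvNl dotvNr opprK (dotv_usphere u1); lra.
Qed.

End Euclidean.

(** * A body with a round shadow and a rim that is not flat *)

Section BumpBody.
Context {R : realType}.
Implicit Types (x u v : 'rV[R]_3) (a b c : R).

Definition vec2 a b : 'rV[R]_2 := \row_i [:: a; b]`_i.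
Definition vec3 a b c : 'rV[R]_3 := \row_i [:: a; b; c]`_i.

Lemma dotv2 (x y : 'rV[R]_2) : dotv x y = x 0 0 * y 0 0 + x 0 1 * y 0 1.
Proof.
rewrite /dotv !big_ord_recl big_ord0 addr0.
by congr (_ + x _ _ * y _ _); apply/val_inj.
Qed.

Lemma dotv3 x y : dotv x y = x 0 0 * y 0 0 + x 0 1 * y 0 1 + x 0 2 * y 0 2.
Proof.
rewrite /dotv !big_ord_recl big_ord0 addr0 addrA.
by congr (_ + x _ _ * y _ _ + x _ _ * y _ _); apply/val_inj.
Qed.

Lemma pr0 x : pr x 0 0 = x 0 0.
Proof. by rewrite prE; congr (x _ _); apply/val_inj. Qed.

Lemma pr1 x : pr x 0 1 = x 0 1.
Proof. by rewrite prE; congr (x _ _); apply/val_inj. Qed.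

Lemma dotv_pr_height x y : dotv x y = dotv (pr x) (pr y) + x 0 2 * y 0 2.
Proof. by rewrite dotv3 dotv2 !pr0 !pr1. Qed.

Definition bump : R := 10^-1.

Definition bump_support v : R := 1 + bump * v 0 2 * v 0 0 ^+ 2.

Definition bump_set : set 'rV[R]_3 :=
  halfspaces (fun v c => usphere v /\ c = bump_support v).

Lemma bump_setP x :
  bump_set x <-> forall v, usphere v -> dotv x v <= bump_support v.
Proof. by split=> [Bx v v1|Bx v c [v1 ->]]; exact: Bx. Qed.

(** The gradient at [u] of the 1-homogeneous extension of [bump_support],
that is, for a unit vector [u], the boundary point with outer normal [u]. *)
Definition bump_grad u : 'rV[R]_3 :=
  (1 - 2 * bump * u 0 2 * u 0 0 ^+ 2) *: u +
  bump *: vec3 (2 * u 0 0 * u 0 2) 0 (u 0 0 ^+ 2).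

Lemma usphere_coord_le1 u i : usphere u -> u 0 i <= 1 /\ - 1 <= u 0 i.
Proof.
move=> /dotv_usphere u1; have := coord_sqr_le u i; rewrite u1.
by split; nra.
Qed.

Lemma bump_grad_supports u : usphere u ->
  dotv (bump_grad u) u = bump_support u.
Proof.
move=> /dotv_usphere; rewrite /bump_grad /bump_support !dotvE => ->.
by rewrite dotv3 !mxE/=; ring.
Qed.

(** The point with normal [u] satisfies the inequality in direction [v]: the
round part leaves a slack of half of [|v - u| ^ 2], and since the perturbation
is [bump] times a smooth function, its first-order Taylor error is at most
[5 * bump * |v - u| ^ 2], which the choice of [bump] makes no larger. *)
Lemma bump_grad_in u : usphere u -> bump_set (bump_grad u).
Proof.
move=> u1; apply/bump_setP => v v1; rewrite /bump_grad /bump_support !dotvE.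
have [x1 x2] := usphere_coord_le1 0 u1; have [z1 z2] := usphere_coord_le1 2 u1.
have [c1 c2] := usphere_coord_le1 2 v1.
move: (dotv_usphere u1) (dotv_usphere v1); rewrite !dotv3 !mxE/=.
move: (u 0 0) (u 0 1) (u 0 2) (v 0 0) (v 0 1) (v 0 2) x1 x2 z1 z2 c1 c2.
move=> x y z x' y' z' x1 x2 z1 z2 c1 c2 u2 v2.
(* a, b, c are the coordinates of v - u, and w is its squared norm *)
pose a := x' - x; pose b := y' - y; pose c := z' - z.
pose w := a ^+ 2 + b ^+ 2 + c ^+ 2.
have uv : x * x' + y * y' + z * z' = 1 - w / 2.
  by rewrite /w /a /b /c; nra.
rewrite uv -subr_ge0.
have -> : 1 + bump * z' * x' ^+ 2 - ((1 - 2 * bump * z * x ^+ 2) * (1 - w / 2) +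
   bump * (2 * x * z * x' + 0 * y' + x ^+ 2 * z')) =
   w / 2 + bump * (z * a ^+ 2 + 2 * x * a * c + c * a ^+ 2 - z * x ^+ 2 * w).
  by rewrite /a /c; field.
have w0 : 0 <= w by rewrite /w; nra.
have aw : a ^+ 2 <= w by rewrite /w; nra.
have acw : a ^+ 2 + c ^+ 2 <= w by rewrite /w; nra.
have h1 : - w <= z * a ^+ 2 by have := sqr_ge0 a; nra.
have h2 : - w <= 2 * x * a * c.
  by have := sqr_ge0 (a + c); have := sqr_ge0 (a - c); nra.
have h3 : - (2 * w) <= c * a ^+ 2.
  have : -2 <= c by rewrite /c; lra.
  by have := sqr_ge0 a; nra.
have h4 : z * x ^+ 2 * w <= w.
  have x0 := sqr_ge0 x.
  have : z * x ^+ 2 <= 1 by nra.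
  by nra.
by rewrite /bump; lra.
Qed.

Lemma bump_ex : exists2 A : cc R 3, cc_set A = bump_set & cw_ 2 A.
Proof.
have [A AE] : exists A : cc R 3, cc_set A = bump_set.
  apply: (@halfspaces_cc _ _ _ (1 + bump)).
    have u1 : usphere (vec3 1 0 0).
      by apply: usphere_dotv; rewrite dotv3 !mxE/=; ring.
    by exists (bump_grad (vec3 1 0 0)); exact: bump_grad_in.
  move=> v v1; exists (bump_support v); first by split.
  have [] := usphere_coord_le1 2 v1; have := coord_sqr_le v 0.
  rewrite (dotv_usphere v1) /bump_support /bump; have := sqr_ge0 (v 0 0).
  by nra.
exists A => // u u1.
have supportE v : usphere v -> Defs.support A v = bump_support v.
  move=> v1; rewrite -(bump_grad_supports v1) AE; apply: support_eq.
    exact: bump_grad_in.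
  by move=> y /bump_setP/(_ v v1); rewrite bump_grad_supports.
rewrite /width (supportE u u1) (supportE _ (usphereN u1)) /bump_support !mxE; ring.
Qed.

(** A piece of the body that is a graph over the whole disc; over the unit
circle it is the rim. *)
Lemma bump_graph (a b : R) : a ^+ 2 + b ^+ 2 <= 1 ->
  bump_set (vec3 a b (bump * a ^+ 2)).
Proof.
move=> ab; apply/bump_setP => v /dotv_usphere; rewrite /bump_support !dotv3 !mxE/=.
move: (v 0 0) (v 0 1) (v 0 2) => x y z v1; rewrite /bump.
have z1 : z <= 1 by nra. have z2 : -1 <= z by nra.
have x1 : x <= 1 by nra. have x2 : -1 <= x by nra.
have a1 : a <= 1 by nra. have a2 : -1 <= a by nra.
have h1 := sqr_ge0 (a - x - z); have h2 := sqr_ge0 (a - x + z).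
have : z * (a - x) * (a + x) <= (a - x) ^+ 2 + z ^+ 2 by nra.
have := sqr_ge0 (b - y).
by nra.
Qed.

Lemma pr_bump : pr @` bump_set = [set x | enorm x <= 1].
Proof.
apply/seteqP; split=> [_ [x /bump_setP Bx <-]|x]/=.
  apply: enormP => // u u1; rewrite dotv_pr; have {Bx}:= Bx (Defs.lift0 u).
  rewrite /bump_support.
  have -> : Defs.lift0 u 0 2 = 0.
    have -> : 2 = rshift 2 0 :> 'I_3 by apply/val_inj.
    by rewrite /Defs.lift0 (@row_mxEr R 1 2 1) mxE.
  rewrite mulr0 mul0r addr0; apply; apply: usphere_dotv.
  by rewrite -dotv_pr pr_lift0 dotv_usphere.
rewrite enorm_le_dotv// dotv2 expr1n => x1.
exists (vec3 (x 0 0) (x 0 1) (bump * x 0 0 ^+ 2)); first exact: bump_graph.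
apply/rowP => i; rewrite prE mxE.
by case: i => -[|[|//]] i /=; congr (x _ _); apply/val_inj.
Qed.

(** A unit direction tilted slightly off the horizontal plane, by an angle with
rational cosine and sine: the inequality of the body in such a direction
estimates the height of the points that are almost extreme horizontally. *)
Definition tilt_cos : R := 9999 / 10001.
Definition tilt_sin : R := 200 / 10001.

Lemma tilt_circle : tilt_cos ^+ 2 + tilt_sin ^+ 2 = 1.
Proof. by rewrite /tilt_cos /tilt_sin; field. Qed.

(** At [(1, 0)] the rim has height [1 / 10]. *)
Lemma bump_high x : bump_set x -> 1 - 1 / 10000 <= x 0 0 -> 8 / 100 <= x 0 2.
Proof.
move=> /bump_setP/(_ (vec3 tilt_cos 0 (- tilt_sin))) Bx x0.
have {Bx} := Bx _; rewrite /bump_support dotv3 !mxE/=.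
rewrite /bump /tilt_cos /tilt_sin => Bx.
suff {}/Bx : usphere (vec3 tilt_cos 0 (- tilt_sin)) by lra.
by apply: usphere_dotv; rewrite dotv3 !mxE/= -[RHS]tilt_circle; ring.
Qed.

(** At [(0, 1)] and [(0, -1)] the rim has height 0. *)
Lemma bump_low x : bump_set x -> 1 - 1 / 10000 <= `|x 0 1| -> x 0 2 <= 2 / 100.
Proof.
move=> /bump_setP Bx x1.
have tilt (s : R) : s ^+ 2 = 1 ->
    x 0 1 * (s * tilt_cos) + x 0 2 * tilt_sin <= 1.
  move=> s1; have {Bx} := Bx (vec3 0 (s * tilt_cos) tilt_sin).
  rewrite /bump_support dotv3 !mxE/= expr0n/= !mulr0 addr0 add0r; apply.
  apply: usphere_dotv; rewrite dotv3 !mxE/= -[RHS]tilt_circle.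
  by transitivity (s ^+ 2 * tilt_cos ^+ 2 + tilt_sin ^+ 2); [ring|rewrite s1 mul1r].
have /tilt : (Num.sg (x 0 1)) ^+ 2 = 1.
  rewrite sqr_sg; have [x10|//] := eqVneq (x 0 1) 0.
  by move: x1; rewrite x10 normr0; lra.
by rewrite mulrA [x 0 1 * _]mulrC -normrEsg /tilt_cos /tilt_sin; lra.
Qed.

End BumpBody.

(** * Intersections of balls centred in a set of diameter 2 *)

Section Reuleaux.
Context {R : realType} {n : nat}.
Implicit Types (S : set 'rV[R]_n) (s t u v x y : 'rV[R]_n) (a b r : R).

Definition ball_hull S : set 'rV[R]_n :=
  [set x | forall s, S s -> enorm (x - s) <= 2].

(** The two diameters of [S] issued from [s] in the directions [- u1] and
[- u2] bound an arc of the hull opposite to [s], and [v] points from that arc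
to [s]. *)
Definition normal_at S s v : Prop := exists u1 u2 a b,
  [/\ S s, S (s - 2 *: u1) /\ S (s - 2 *: u2), usphere u1 /\ usphere u2,
      0 <= a /\ 0 <= b & v = a *: u1 + b *: u2].

(** The combinatorics of the vertices of a Reuleaux polygon: in the plane, the
normal cones of the vertices and their opposites cover all directions. *)
Definition star_set S : Prop :=
  (forall s t, S s -> S t -> enorm (s - t) <= 2) /\
  (forall u, usphere u -> exists s, normal_at S s u \/ normal_at S s (- u)).

(** The point [s - 2 v] of the arc opposite to [s] is within 2 of [y]: writing
[D = s - y], this means [|D| ^ 2 <= 4 <D, v>].  The inequality holds for [u1]
and [u2] since the end points of the arc are in [S], and it passes to
[v = a u1 + b u2] because [a + b >= |v| = 1]. *)
Lemma ball_hull_arc S s v y : usphere v -> normal_at S s v -> ball_hull S y ->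
  enorm (y - (s - 2 *: v)) <= 2.
Proof.
move=> v1 [u1 [u2 [a [b [Ss [S1 S2] [u11 u21] [a0 b0] vE]]]]] Sy.
have ab : 1 <= a + b.
  rewrite -v1 vE; apply: le_trans (enormD _ _) _.
  by rewrite !enormZ u11 u21 !ger0_norm// !mulr1.
have cap u : usphere u ->
    (enorm (y - (s - 2 *: u)) <= 2) = (dotv (s - y) (s - y) <= 4 * dotv (s - y) u).
  move=> /dotv_usphere u1u; rewrite enorm_le_dotv//.
  have -> : y - (s - 2 *: u) = 2 *: u - (s - y).
    by apply/rowP => i; rewrite !mxE; ring.
  move: (s - y) => D; rewrite !dotvE u1u (dotvC u D).
  by apply/idP/idP; lra.
move: (Sy _ S1) (Sy _ S2); rewrite !cap// vE; move: (s - y) => D h1 h2.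
by rewrite dotvDr !dotvZr; have := dotv_ge0 D; nra.
Qed.

(** In a direction [v] normal at [s], the hull is supported by [s], and in the
direction [- v] by the point [s - 2 v], which belongs to it by
[ball_hull_arc]. *)
Lemma ball_hull_cw S : (usphere : set 'rV[R]_n) !=set0 -> star_set S ->
  exists2 K : cc R n, cc_set K = ball_hull S & cw_ 2 K.
Proof.
move=> [u0 u01] [Sdiam Snorm].
have SK s : S s -> ball_hull S s by move=> Ss t St; exact: Sdiam.
have [s0 Ss0] : S !=set0.
  by have [s [] [? [? [? [? []]]]]] := Snorm _ u01; exists s.
have [K KE] : exists K : cc R n, cc_set K = ball_hull S.
  pose H v c := usphere v /\ exists2 s, S s & c = dotv s v + 2.
  have -> : ball_hull S = halfspaces H.
    apply/seteqP; split=> [x Sx v c [v1 [s Ss ->]]|x Hx s Ss].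
      by have := dotv_le v1 (Sx s Ss); rewrite dotvDl dotvNl; lra.
    apply: enormP => // v v1; rewrite dotvDl dotvNl lerBlDl.
    by apply: Hx; split=> //; exists s.
  apply: (@halfspaces_cc _ _ _ (enorm s0 + 2)).
    exists s0 => v c [v1 [s Ss ->]].
    by have := dotv_le v1 (Sdiam _ _ Ss0 Ss); rewrite dotvDl dotvNl; lra.
  move=> v v1; exists (dotv s0 v + 2); first by split=> //; exists s0.
  by rewrite lerD2r dotv_le.
have widthE s v : usphere v -> normal_at S s v -> width K v = 2.
  move=> v1 sv; have Ss : S s by case: sv => ? [? [? [? []]]].
  have v1' := dotv_usphere v1.
  rewrite /width KE (@support_eq _ _ _ s)//; first last.
  - move=> y /(ball_hull_arc v1 sv)/(dotv_le v1).
    by rewrite !dotvE v1'; lra.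
  - exact: SK.
  rewrite (@support_eq _ _ _ (s - 2 *: v)); first by rewrite !dotvE v1'; ring.
    by move=> t St; rewrite enormB; apply: ball_hull_arc (SK _ St).
  move=> y /(_ _ Ss); rewrite enormB => /(dotv_le v1).
  by rewrite !dotvE v1'; lra.
exists K => // u u1; have [s [su|su]] := Snorm u u1; first exact: widthE su.
by rewrite -(widthE _ _ (usphereN u1) su) /width opprK addrC.
Qed.

(** With [cw_sub_ball], this squeezes the hull between two concentric balls when
[r] is close to 1. *)
Lemma ball_hull_disc S r x : r <= 2 -> (forall s, S s -> enorm s <= r) ->
  enorm x <= 1 -> ball_hull S ((2 - r) *: x).
Proof.
move=> r2 Sr x1 s Ss; apply: le_trans (enormD _ _) _.
by rewrite enormN enormZ ger0_norm ?subr_ge0//; have := Sr s Ss; nra.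
Qed.

End Reuleaux.

(** * Unit vectors of the plane *)

Section Angles.
Context {R : realType}.
Implicit Types (t a c h s : R) (k j m : nat).

Definition unit_at t : 'rV[R]_2 := vec2 (cos t) (sin t).

Lemma unit_at_usphere t : usphere (unit_at t).
Proof. by apply: usphere_dotv; rewrite dotv2 !mxE/= -!expr2 cos2Dsin2. Qed.

Lemma unit_atDpi t : unit_at (t + pi) = - unit_at t.
Proof.
by apply/rowP => i; rewrite !mxE cosDpi sinDpi; case: i => -[|[|]]//=; rewrite oppr0.
Qed.

Lemma unit_at_sum c h : unit_at (c - h) + unit_at (c + h) = (2 * cos h) *: unit_at c.
Proof.
apply/rowP => i; rewrite !mxE cosB sinB cosD sinD.
by case: i => -[|[|]]//= _; ring.
Qed.

Lemma unit_at_cone a h s :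
  sin h *: unit_at (a + s) = sin (h - s) *: unit_at a + sin s *: unit_at (a + h).
Proof.
apply/rowP => i; rewrite !mxE sinB !cosD !sinD.
by case: i => -[|[|]]//= _; ring.
Qed.

(** The sign avoids the angles beyond [pi], where [acos] takes no values. *)
Lemma unit_at_surj (u : 'rV[R]_2) : usphere u ->
  exists2 t, 0 <= t & u = unit_at t \/ - u = unit_at t.
Proof.
move=> u1; have := dotv_usphere u1; rewrite dotv2 => uu.
have x1 : -1 <= u 0 0 <= 1 by apply/andP; split; nra.
have := sin_acos x1; have -> : 1 - u 0 0 ^+ 2 = u 0 1 ^+ 2 by lra.
rewrite sqrtr_sqr => sE.
have cE : cos (acos (u 0 0)) = u 0 0 by rewrite acosK.
have uE t : cos t = u 0 0 -> sin t = u 0 1 -> u = unit_at t.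
  move=> ct st; apply/rowP => -[[|[|]]//= i]; rewrite mxE/= ?ct ?st;
  by congr (u _ _); apply/val_inj.
have [y0|y0] := leP 0 (u 0 1).
  exists (acos (u 0 0)); first exact: acos_ge0.
  by left; apply: uE => //; rewrite sE ger0_norm.
exists (pi - acos (u 0 0)); first by rewrite subr_ge0 acos_lepi.
right; rewrite -[RHS]opprK; congr (- _).
rewrite -unit_atDpi; apply: uE.
  by rewrite cosDpi cosB cospi sinpi cE; ring.
by rewrite sinDpi sinB cospi sinpi sE ltr0_norm//; ring.
Qed.

End Angles.

(** * Regular Reuleaux polygons *)

Section StarPolygon.
Context {R : realType}.
Variable k : nat.
Hypothesis k_gt0 : (0 < k)%N.
Implicit Types (t s : R) (j m l : nat).

(* the number of vertices *)
Let N := k.*2.+1.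

Definition star_step : R := pi / N%:R.
Local Notation th := star_step.

(** The circumradius for which the diameter of the vertex set is 2. *)
Definition star_radius : R := (cos (th / 2))^-1.

(** The alternating sign enumerates the vertices along the star: consecutive
vertices are as far apart as possible.  The enumeration is periodic
of period [N], as [N] is odd. *)
Definition star_vertex m : 'rV[R]_2 :=
  ((-1) ^+ m * star_radius) *: unit_at (m%:R * th).

Lemma star_stepN : N%:R * th = pi.
Proof. by rewrite /star_step mulrC divfK// pnatr_eq0. Qed.

Lemma star_step_gt0 : 0 < th.
Proof. by rewrite divr_gt0 ?pi_gt0// ltr0n. Qed.

Lemma star_step_le : 3 * th <= pi.
Proof.
rewrite -star_stepN ler_pM2r ?star_step_gt0// ler_nat /N.
by rewrite ltnS -[2%N]/(1.*2) leq_double.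
Qed.

Lemma cos_half_step_gt0 : 0 < cos (th / 2).
Proof.
apply: cos_gt0_pihalf; have := star_step_le; have := star_step_gt0.
by move=> h1 h2; apply/andP; split; lra.
Qed.

Lemma star_radius_cos : star_radius * cos (th / 2) = 1.
Proof. by rewrite mulVf// gt_eqF// cos_half_step_gt0. Qed.

Lemma star_radius_gt0 : 0 < star_radius.
Proof. by rewrite invr_gt0 cos_half_step_gt0. Qed.

(** Consecutive vertices are at distance exactly 2. *)
Lemma star_vertex_diff m :
  star_vertex m - star_vertex m.+1 = 2 *: ((-1) ^+ m *: unit_at ((m%:R + 2^-1) * th)).
Proof.
rewrite /star_vertex exprS mulN1r mulNr scaleNr opprK -scalerDr.
have -> : m%:R * th = (m%:R + 2^-1) * th - th / 2 by ring.
have -> : m.+1%:R * th = (m%:R + 2^-1) * th + th / 2.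
  by rewrite -natr1; field.
rewrite unit_at_sum !scalerA; congr (_ *: _).
transitivity (2 * (-1) ^+ m * (star_radius * cos (th / 2))); first by ring.
by rewrite star_radius_cos mulr1.
Qed.

(** The cosine of an odd multiple of [pi / N] is at most [cos (pi / N)].  Even
[j] reduce to odd ones through [pi - j * th = (N - j) * th], [N] being odd. *)
Lemma star_cos j : - cos th <= (-1) ^+ j * cos (j%:R * th).
Proof.
have th0 := star_step_gt0; have thpi := star_step_le.
have cosle (x : R) : th <= x -> x <= pi -> cos x <= cos th.
  move=> thx xpi; rewrite leNgt ltr_cos ?in_itv/= -?leNgt//; apply/andP; split; lra.
(* the expression has period N in j, so that only j < N matters *)
have red i : (-1) ^+ (i + N) * cos ((i + N)%:R * th) = (-1) ^+ i * cos (i%:R * th).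
  have sgnN : (-1) ^+ N = -1 :> R by rewrite -signr_odd /N oddS odd_double.
  by rewrite natrD mulrDl star_stepN cosDpi exprD sgnN; ring.
suff lt_N i : (i < N)%N -> - cos th <= (-1) ^+ i * cos (i%:R * th).
  rewrite (divn_eq j N); have : (j %% N < N)%N by rewrite ltn_mod.
  move: (j %% N)%N => i iN; elim: (j %/ N)%N => [|q IHq]; first exact: lt_N.
  by rewrite mulSn -addnA addnC red.
move=> iN.
have iNth : i.+1%:R * th <= pi by rewrite -[leRHS]star_stepN ler_pM2r// ler_nat.
rewrite -signr_odd; case: (boolP (odd i)) => [iodd|_].
  rewrite expr1 mulN1r lerN2; apply: cosle.
    by rewrite ler_peMl ?(ltW th0)// ler1n; case: i iodd {iN iNth}.
  by apply: le_trans iNth; rewrite ler_pM2r// ler_nat.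
rewrite expr0 mul1r lerNl.
have -> : - cos (i%:R * th) = cos (pi - i%:R * th).
  by rewrite cosB cospi sinpi; ring.
apply: cosle; last first.
  by rewrite gerBl mulr_ge0// ltW.
by rewrite -natr1 mulrDl mul1r in iNth; lra.
Qed.

(** The squared distance is [2 r ^ 2 (1 - (-1) ^ j cos (j th))] with
[j = m - l], and [r ^ 2 (1 + cos th) = 2]. *)
Lemma star_vertex_diam m l : enorm (star_vertex m - star_vertex l) <= 2.
Proof.
wlog lm : m l / (l <= m)%N.
  by move=> hw; have [/hw//|/ltnW/hw] := leqP l m; rewrite enormB.
rewrite enorm_le_dotv//.
have -> : dotv (star_vertex m - star_vertex l) (star_vertex m - star_vertex l) =
    2 * star_radius ^+ 2 * (1 - (-1) ^+ (m - l) * cos ((m - l)%:R * th)).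
  rewrite -(subnK lm); move: (m - l)%N => j.
  rewrite addnK dotv2 /star_vertex !mxE/= natrD [(_ + _) * th]mulrDl.
  move: (j%:R * th) (l%:R * th) => a b.
  have -> : cos a = cos (a + b) * cos b + sin (a + b) * sin b.
    by rewrite -cosB addrK.
  rewrite exprD; have := cos2Dsin2 (a + b); have := cos2Dsin2 b.
  have := sqrr_sign R j; have := sqrr_sign R l.
  move: ((-1) ^+ j) ((-1) ^+ l) => sj sl sl2 sj2 b2 ab2.
  transitivity (star_radius ^+ 2 * (sl ^+ 2 * (sj ^+ 2 *
      (cos (a + b) ^+ 2 + sin (a + b) ^+ 2) + (cos b ^+ 2 + sin b ^+ 2) -
      2 * sj * (cos (a + b) * cos b + sin (a + b) * sin b)))); first by ring.
  by rewrite sl2 sj2 b2 ab2; ring.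
have := star_cos (m - l); have : star_radius ^+ 2 * (1 + cos th) = 2.
  have -> : 1 + cos th = 2 * cos (th / 2) ^+ 2.
    have {1}-> : th = th / 2 + th / 2 by field.
    by rewrite cosD -!expr2; have := cos2Dsin2 (th / 2); lra.
  transitivity (2 * (star_radius * cos (th / 2)) ^+ 2); first by ring.
  by rewrite star_radius_cos expr1n mulr1.
by have := sqr_ge0 star_radius; nra.
Qed.

(** The vertex of index [i] has its diameters in the directions
[(-1) ^ i * unit_at ((i - 1/2) th)] and [(-1) ^ i * unit_at ((i + 1/2) th)], so
the angle [t] belongs, up to sign, to the vertex whose index is the integer
nearest to [t / th]. *)
Lemma star_set_vertices : star_set (range star_vertex).
Proof.
split=> [_ _ [m _ <-] [l _ <-]|u /unit_at_surj[t0 t00 ut]]; first exact: star_vertex_diam.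
have th0 := star_step_gt0; have thpi := star_step_le.
(* shifting the angle by pi makes room for a predecessor of the vertex *)
pose t := t0 + pi.
have {t00}tpi : pi <= t by rewrite /t; lra.
have [j /andP[jt tj]] : exists j, (j.+1%:R - 2^-1) * th <= t < (j.+1%:R + 2^-1) * th.
  have x0 : 1 <= t / th + 2^-1.
    rewrite (le_trans (_ : 1 <= t / th)) ?lerDl ?invr_ge0//.
    by rewrite ler_pdivlMr//; lra.
  have /truncn_itv : 0 <= t / th + 2^-1 by lra.
  have := x0; rewrite -truncn_gt0.
  case: (truncn _) => // j _; rewrite -lerBlDr -ltrBrDr.
  rewrite ler_pdivlMr// ltr_pdivrMr// => /andP[h1 h2]; exists j; rewrite h1/=.
  by move: h2; rewrite -(natr1 j.+1); lra.
exists (star_vertex j.+1).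
suff sj : normal_at (range star_vertex) (star_vertex j.+1) ((-1) ^+ j.+1 *: unit_at t).
  have : unit_at t = u \/ unit_at t = - u.
    by rewrite /t unit_atDpi; case: ut => <-; rewrite ?opprK; [right|left].
  move: sj; rewrite -signr_odd; case: (odd _);
    rewrite ?expr0 ?expr1 ?scale1r ?scaleN1r => sj [<-|uE];
    rewrite -?uE; [right|left; move: sj; rewrite uE opprK|left|right]; by [].
pose s := t - (j%:R + 2^-1) * th.
exists ((-1) ^+ j.+1 *: unit_at ((j%:R + 2^-1) * th)),
       ((-1) ^+ j.+1 *: unit_at ((j.+1%:R + 2^-1) * th)),
       (sin (th - s) / sin th), (sin s / sin th).
have sth : 0 < sin th by apply: sin_gt0_pi; apply/andP; split; lra.
have signu i (x : R) : usphere ((-1) ^+ i *: unit_at x).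
  by rewrite /usphere/= enormZ normrX normrN1 expr1n mul1r unit_at_usphere.
have s_ge0 : 0 <= s by move: jt; rewrite -natr1 /s; lra.
have s_lt : s <= th by move: tj; rewrite -natr1 /s; lra.
split=> //.
- split; last by exists j.+2 => //; rewrite -star_vertex_diff subKr.
  exists j => //.
  by rewrite exprS mulN1r scaleNr scalerN opprK -star_vertex_diff addrC subrK.
- by split; rewrite divr_ge0 ?(ltW sth)// sin_ge0_pi//; apply/andP; split; lra.
have := unit_at_cone ((j%:R + 2^-1) * th) th s.
have -> : (j%:R + 2^-1) * th + s = t by rewrite /s; ring.
have -> : (j%:R + 2^-1) * th + th = (j.+1%:R + 2^-1) * th by rewrite -natr1; ring.
move=> /(congr1 (fun w => ((-1) ^+ j.+1 / sin th) *: w)).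
rewrite scalerDr !scalerA divfK ?gt_eqF// => ->.
by congr (_ *: _ + _ *: _); ring.
Qed.

Lemma star_vertex0 : star_vertex 0 0 0 = star_radius.
Proof. by rewrite /star_vertex !mxE/= mul0r cos0 expr0 mul1r mulr1. Qed.

(** The angle of this vertex, [k * th], is [pi / 2 - th / 2]. *)
Lemma star_vertex_top : `|star_vertex k 0 1| = 1.
Proof.
rewrite /star_vertex !mxE/= !normrM normrX normrN1 expr1n mul1r.
have -> : k%:R * th = pi / 2 - th / 2.
  by rewrite -star_stepN /N -addn1 -mul2n natrD natrM; field.
rewrite sinB sin_pihalf cos_pihalf mul0r subr0 mul1r -normrM star_radius_cos.
by rewrite normr1.
Qed.

End StarPolygon.

(** * Rigidity of bodies with a Reuleaux shadow *)

Section NotOpen.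
Context {R : realType}.

Lemma star_radius_cvg (e : R) : 0 < e ->
  exists2 k : nat, (0 < k)%N & star_radius k < 1 + e :> R.
Proof.
move=> e0.
have half : {for (0 : R), continuous (@cos R \o ( *%R^~ (2^-1 : R)))}.
  by apply: continuous_comp; [exact: mulrr_continuous|exact: continuous_cos].
have rad : (cos (t / 2))^-1 @[t --> (0 : R)] --> (cos (0 / 2) : R)^-1.
  by apply: cvgV half; rewrite /= mul0r cos0 oner_neq0.
rewrite mul0r cos0 invr1 in rad.
have /nbhs_ballP[d /= d0 dP] : \forall t \near (0 : R), (cos (t / 2))^-1 < 1 + e.
  by apply: cvgr_lt rad _ _; rewrite ltrDl.
exists (truncn (pi / d)).+1 => //; apply: dP; rewrite -ball_normE/= sub0r normrN.
rewrite ger0_norm ?ltW ?star_step_gt0// /star_step ltr_pdivrMr ?ltr0n//.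
rewrite mulrC -ltr_pdivrMr//.
apply: lt_le_trans (truncnS_gt _) _; rewrite ler_nat.
by rewrite -addnn -addnS leq_addr.
Qed.

(** The horizontal distance already exhausts the diameter 2, which leaves no
room for a vertical difference. *)
Lemma star_lift_height (k : nat) (A : cc R 3) (m : nat) x y : (0 < k)%N ->
  cw_ 2 A -> cc_set A x -> cc_set A y ->
  pr x = star_vertex k m -> pr y = star_vertex k m.+1 -> x 0 2 = y 0 2.
Proof.
move=> k0 A2 Ax Ay xm ym.
have := cw_diam (ler0n _ 2) A2 Ax Ay; rewrite enorm_le_dotv ?ler0n//.
have prB : pr (x - y) = star_vertex k m - star_vertex k m.+1.
  by rewrite -xm -ym /pr linearB.
rewrite dotv_pr_height prB star_vertex_diff//.
have u1 : dotv ((-1) ^+ m *: unit_at ((m%:R + 2^-1) * star_step k))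
               ((-1) ^+ m *: unit_at ((m%:R + 2^-1) * star_step k)) = 1 :> R.
  by apply: dotv_usphere; rewrite /usphere/= enormZ normrX normrN1 expr1n mul1r unit_at_usphere.
rewrite dotvZl dotvZr u1 !mxE => h.
by have := sqr_ge0 (x 0 2 - y 0 2); nra.
Qed.


(** All vertices lift to one height by [star_lift_height], while [bump_high] and
[bump_low] separate the heights of the points of the unperturbed body near the
lifts of the vertices of index 0 and [k]. *)
Lemma far_from_bump (k : nat) (A0 A : cc R 3) : (0 < k)%N ->
  cc_set A0 = bump_set -> cw_ 2 A ->
  (forall m, exists2 x, cc_set A x & pr x = star_vertex k m) ->
  1 / 10000 <= hdist A0 A.
Proof.
move=> k0 A0E A2 lifts; rewrite leNgt; apply/negP => /hradii_gt[_ _ near].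
have [h hE] : exists h, forall m x, cc_set A x -> pr x = star_vertex k m -> x 0 2 = h.
  have [x0 Ax0 x0E] := lifts 0; exists (x0 0 2); elim=> [|m IHm] x Ax xE.
    have [y Ay yE] := lifts 1.
    by rewrite (star_lift_height k0 A2 Ax Ay xE yE) (star_lift_height k0 A2 Ax0 Ay x0E yE).
  have [y Ay yE] := lifts m.
  by rewrite -(IHm y Ay yE) (star_lift_height k0 A2 Ay Ax yE xE).
have coord (x a : 'rV[R]_3) i : enorm (x - a) < 1 / 10000 -> `|x 0 i - a 0 i| < 1 / 10000.
  apply: le_lt_trans; rewrite -(@ler_pXn2r _ 2)// ?nnegrE ?enorm_ge0//.
  rewrite real_normK ?num_real// enorm_sqr.
  by have := coord_sqr_le (x - a) i; rewrite !mxE.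
have [x Ax xE] := lifts 0; have [y Ay yE] := lifts k.
have xh := hE _ _ Ax xE; have yh := hE _ _ Ay yE.
have [a + xa] := near x Ax; have [b + yb] := near y Ay.
rewrite A0E => Bb Ba.
have r1 : 1 <= star_radius k :> R.
  rewrite -[leLHS](star_radius_cos (R:=R) k0) ler_piMr ?cos_le1// ltW//; exact: star_radius_gt0.
have ha : 8 / 100 <= a 0 2.
  apply: bump_high => //; have := coord _ _ 0 xa.
  by rewrite -pr0 xE star_vertex0 ltr_norml => /andP[_]; lra.
have hb : b 0 2 <= 2 / 100.
  apply: bump_low => //; have := coord _ _ 1 yb; have := star_vertex_top (R:=R) k0.
  rewrite -yE pr1 => y1; have := lerB_dist (y 0 1) (b 0 1).
  by rewrite y1; lra.
have := coord _ _ 2 xa; have := coord _ _ 2 yb; rewrite xh yh.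
by rewrite !ltr_norml => /andP[b1 b2] /andP[a1 a2]; move: a1 b2 {A0E} ha hb; lra.
Qed.

(** The scalings by [2 - r] and by [1 / r], where [r] is the circumradius, carry
the disc into the polygon and the polygon into the disc. *)
Lemma hdist_disc_star (k : nat) (D K : cc R 2) (e : R) : (0 < k)%N ->
  cc_set D = [set x | enorm x <= 1] ->
  cc_set K = ball_hull (range (star_vertex k)) -> cw_ 2 K ->
  e <= 1 -> star_radius k < 1 + e -> hdist D K <= e.
Proof.
move=> k0 DE KE K2 e1 re.
have r0 : 0 < star_radius k :> R by exact: star_radius_gt0.
have r1 : 1 <= star_radius k :> R.
  by rewrite -[leLHS](star_radius_cos (R:=R) k0) ler_piMr ?cos_le1// ltW.
have i0 : 0 <= (star_radius k)^-1 :> R by rewrite invr_ge0 ltW.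
have DK (x : 'rV[R]_2) : enorm x <= 1 -> cc_set K ((2 - star_radius k) *: x).
  rewrite KE; apply: ball_hull_disc; first by lra.
  move=> _ [m _ <-]; rewrite /star_vertex enormZ unit_at_usphere mulr1.
  by rewrite normrM normrX normrN1 expr1n mul1r ger0_norm// ltW.
apply: hdist_le; split; first by lra.
- move=> x; rewrite DE/= => x1; exists ((2 - star_radius k) *: x); first exact: DK.
  have -> : x - (2 - star_radius k) *: x = (star_radius k - 1) *: x.
    by apply/rowP => i; rewrite !mxE; ring.
  by rewrite enormZ ger0_norm ?subr_ge0//; have := enorm_ge0 x; nra.
- move=> x /(cw_sub_ball (ltW r0) K2 DK) xr.
  exists ((star_radius k)^-1 *: x).
    by rewrite DE/= enormZ ger0_norm// ler_pdivrMl// mulr1.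
  have -> : x - (star_radius k)^-1 *: x = (1 - (star_radius k)^-1) *: x.
    by rewrite scalerBl scale1r.
  have i1 : (star_radius k)^-1 <= 1 :> R by rewrite invf_le1.
  rewrite enormZ ger0_norm ?subr_ge0//.
  have : (1 - (star_radius k)^-1) * enorm x <= (1 - (star_radius k)^-1) * star_radius k.
    by rewrite ler_wpM2l// subr_ge0.
  by rewrite [leRHS]mulrBl mul1r mulVf ?gt_eqF//; lra.
Qed.

End NotOpen.

Theorem corollary2p2 (R : realType) : ~ open_map (p R).
Proof.
move=> p_open.
have [A0 A0E A02] := @bump_ex R.
have A0cw : cw R 3 A0 by exists 2 => //=; rewrite ltr0n.
pose a0 : cw R 3 := exist _ A0 (mem_set A0cw).
pose U : set (cw R 3) := set_val @^-1` (ball A0 (1 / 10000 : R))^°.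
have [V Vopen VU] : open (p R @` U).
  by apply: p_open; exists (ball A0 (1 / 10000 : R))^° => //; exact: open_interior.
have /nbhs_ballP[e /= e0 eV] : nbhs (pr_cc A0) V.
  apply: open_nbhs_nbhs; split=> //.
  have : (p R @` U) (p R a0).
    by exists a0 => //; apply: nbhsx_ballx; lra.
  by rewrite -VU.
have e'0 : 0 < Num.min (e / 2) 1 by rewrite lt_min ltr01 andbT divr_gt0.
have [k k0 kr] := star_radius_cvg e'0.
have [K KE K2] : exists2 K : cc R 2,
    cc_set K = ball_hull (range (star_vertex k)) & cw_ 2 K.
  apply: ball_hull_cw; last exact: star_set_vertices.
  by exists (unit_at 0); exact: unit_at_usphere.
have Kcw : cw R 2 K by exists 2 => //=; rewrite ltr0n.
have VK : V K.
  apply: eV; rewrite ballEmdist/=.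
  have DE : cc_set (pr_cc A0) = [set x | enorm x <= 1] by rewrite /= A0E pr_bump.
  have := hdist_disc_star k0 DE KE K2; move=> /(_ _ _ kr) h.
  apply: (le_lt_trans (h _)); rewrite ?ge_min ?lexx ?orbT//.
  by rewrite gt_min; apply/orP; left; lra.
have [a Ua paK] : (p R @` U) (exist _ K (mem_set Kcw)) by rewrite -VU.
have prA : pr @` (set_val a) = K by rewrite -pE paK.
have A2 : cw_ 2 (set_val a).
  have [d d0 Ad] := set_valP a; suff <- : d = 2 by [].
  have u1 := unit_at_usphere (0 : R).
  by rewrite -(pr_cw_ Ad u1) /= prA K2.
have := interior_subset Ua; rewrite ballEmdist/= => near.
have := far_from_bump k0 A0E A2 _; rewrite leNgt.
move=> /(_ _)/negP; apply=> //.
move=> m; have : cc_set K (star_vertex k m).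
  by rewrite KE => _ [l _ <-]; exact: star_vertex_diam.
by rewrite -prA => -[x Ax xE]; exists x.
Qed.
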